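(* Let $w(x;t)=|x-k|^{\gamma}\exp\{-v(x;t)\}$ for $x,t,k\in\mathbb{R}$, with $\gamma\ge1$ and $v(x;t)$ an even, continuously differentiable function of $x$ on $\mathbb{R}$. Let $\{P_n(x;t)\}_{n=0}^{\infty}$ be the monic polynomials in $x$, $\deg P_n=n$, satisfying $$\int_{-\infty}^{\infty}P_n(x;t)P_m(x;t)\,w(x;t)\,dx=h_n\delta_{mn},\qquad h_n>0,$$ and the three-term recurrence relation $P_{n+1}(x;t)=xP_n(x;t)-\beta_nP_{n-1}(x;t)$ with $P_0=1$, $P_1=x$. Then (for $n\ge2$) $$(x-k)\frac{d^2P_n}{dx^2}(x;t)+R_n(x;t)\frac{dP_n}{dx}(x;t)+T_n(x;t)P_n(x;t)=0,$$ where $$R_n(x;t)=\gamma-(x-k)\frac{dv}{dx}(x;t)-\frac{x-k}{A_n(x;t)}\frac{dA_n}{dx}(x;t)+1,$$ $$T_n(x;t)=\frac{A_n(x;t)A_{n-1}(x;t)}{(x-k)\beta_{n-1}}+\frac{dB_n}{dx}(x;t)+\frac{\gamma B_n(x;t)}{x-k}-B_n(x;t)\left[\frac{dv}{dx}(x;t)+\frac{B_n(x;t)}{x-k}\right]-\frac{B_n(x;t)}{A_n(x;t)}\frac{dA_n}{dx}(x;t),$$ with $$A_n(x;t)=\frac{x-k}{h_{n-1}}\int_{-\infty}^{\infty}P_n^2(y;t)\,\mathcal{K}(x,y)\,w(y;t)\,dy,$$ $$B_n(x;t)=\frac{x-k}{h_{n-1}}\int_{-\infty}^{\infty}P_n(y;t)P_{n-1}(y;t)\,\mathcal{K}(x,y)\,w(y;t)\,dy+\tfrac12\gamma[1-(-1)^n],$$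 and $\mathcal{K}(x,y)=\dfrac{v'(x;t)-v'(y;t)}{x-y}$.
   Context: A prime on $v$ denotes the derivative with respect to the first variable: $v'(x;t)=\frac{dv}{dx}(x;t)$. Here $t$, $k$ and $\gamma$ are real parameters and $\delta_{mn}$ is the Kronecker delta. The coefficients $\beta_n$ do not depend on $x$, and $\beta_n=h_n/h_{n-1}$ for $n\ge1$. All moments $\int_{\mathbb{R}}x^n w(x;t)\,dx$, $n\ge0$, are assumed to exist, and the integrals defining $A_n$ and $B_n$ are assumed to converge. The differential equation is understood where the expressions $R_n$ and $T_n$ are defined. *)

(* Defs.v *)
From HB Require Import structures.
From mathcomp Require Import all_boot all_order all_algebra.
From mathcomp Require Import all_classical all_reals all_analysis.

Set Implicit Arguments.
Unset Strict Implicit.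
Unset Printing Implicit Defensive.

Import Order.TTheory GRing.Theory Num.Theory.
Import numFieldNormedType.Exports.

Local Open Scope classical_set_scope.
Local Open Scope ring_scope.

(* [v x t] and [P n t], [h n t], [beta n t] depend on the parameter [t]; all
   derivatives are taken in [x]. *)

Definition dvdx (R : realType) (v : R -> R -> R) (t x : R) : R :=
  derive1 (fun y : R => v y t) x.

Definition weight (R : realType) (k gamma : R) (v : R -> R -> R) (t x : R) : R :=
  (`|x - k| `^ gamma) * expR (- v x t).

(* On the diagonal [y = x], a null set in the integrals below, division by zero
   gives the value 0. *)
Definition Kker (R : realType) (v : R -> R -> R) (t x y : R) : R :=
  (dvdx v t x - dvdx v t y) / (x - y).

Definition A_integrand (R : realType) (k gamma : R) (v : R -> R -> R)
    (P : nat -> R -> {poly R}) (n : nat) (t x y : R) : R :=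
  (P n t).[y] ^+ 2 * Kker v t x y * weight k gamma v t y.

Definition B_integrand (R : realType) (k gamma : R) (v : R -> R -> R)
    (P : nat -> R -> {poly R}) (n : nat) (t x y : R) : R :=
  (P n t).[y] * (P n.-1 t).[y] * Kker v t x y * weight k gamma v t y.

(* [A_coef] and [B_coef] are meaningful for [1 <= n] only, because of the
   index [n.-1]. *)
Definition A_coef (R : realType) (k gamma : R) (v : R -> R -> R)
    (P : nat -> R -> {poly R}) (h : nat -> R -> R) (n : nat) (t x : R) : R :=
  (x - k) / h n.-1 t *
  \int[@lebesgue_measure R]_y A_integrand k gamma v P n t x y.

Definition B_coef (R : realType) (k gamma : R) (v : R -> R -> R)
    (P : nat -> R -> {poly R}) (h : nat -> R -> R) (n : nat) (t x : R) : R :=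
  (x - k) / h n.-1 t *
  \int[@lebesgue_measure R]_y B_integrand k gamma v P n t x y
  + 2^-1 * gamma * (1 - (-1) ^+ n).

Definition R_coef (R : realType) (k gamma : R) (v : R -> R -> R)
    (P : nat -> R -> {poly R}) (h : nat -> R -> R) (n : nat) (t x : R) : R :=
  let A := A_coef k gamma v P h n t in
  gamma - (x - k) * dvdx v t x - (x - k) / A x * derive1 A x + 1.

Definition T_coef (R : realType) (k gamma : R) (v : R -> R -> R)
    (P : nat -> R -> {poly R}) (h beta : nat -> R -> R) (n : nat)
    (t x : R) : R :=
  let A := A_coef k gamma v P h n t in
  let A1 := A_coef k gamma v P h n.-1 t in
  let B := B_coef k gamma v P h n t in
  A x * A1 x / ((x - k) * beta n.-1 t)
  + derive1 B x
  + gamma * B x / (x - k)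
  - B x * (dvdx v t x + B x / (x - k))
  - B x / A x * derive1 A x.

(* Main.v *)
Require Import Defs.
From HB Require Import structures.
From mathcomp Require Import all_boot all_order all_algebra.
From mathcomp Require Import all_classical all_reals all_analysis.
From mathcomp Require Import measurable_realfun ring lra.

Set Implicit Arguments.
Unset Strict Implicit.
Unset Printing Implicit Defensive.

Import Order.TTheory GRing.Theory Num.Theory.
Import numFieldNormedType.Exports.

Local Open Scope classical_set_scope.
Local Open Scope ring_scope.

(** The recurrence without a middle term forces k = 0: orthogonality of P_0 = 1
    and P_1 = X says that the first moment of w vanishes, while the even
    factor exp(-v) makes k y (w(y) - w(-y)) negative for all y <> 0 as soon as
    k <> 0 ([weight_center_eq0]). So w(y) = |y|^gamma exp(-v(y)) is even.

    For this weight put L(p) = int p w and M(p) = int p v' w, two linear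
    functionals on polynomials. The kernel at x = 0 is v'(y)/y, so convergence
    of the integrals B_m(0), together with the recurrence, gives the convergence
    of every M(p) ([integrable_dv]). Integrating the derivative of y q(y) w(y)
    over the line yields
      L(X q' + (1 + gamma) q) = M(X q)              ([pearson_equation]),
    which, with M(P_n^2) = 0 by parity, is all that the ladder relations use
    about v. The factor y matters: it makes the differentiated function C^1
    across the singularity of |y|^gamma, so that the terms w/y of the classical
    derivation never occur.

    The rest is algebra. Let K_n(x,y) be the Christoffel-Darboux kernel.
    Substituting q = P_n K_n(x,.) and q = P_(n-1) K_n(x,.) above, and using the
    reproducing property and the closed form of (x - y) K_n(x,y), one gets
    x P_n'(x) and x P_(n-1)'(x) in terms of M(P_n K_n) and M(P_(n-1) K_n)
    ([lowering], [raising]). Since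
      (x - y) K_n(x,y) (v'(x) - v'(y))/(x - y) = K_n(x,y) (v'(x) - v'(y)),
    those two values of M are combinations of the integrals in A_n, B_n and
    A_(n-1) ([kernel_integral]), which turns the two identities into
      x P_n' = A_n P_(n-1) - B_n P_n,
      x P_(n-1)' = (x v' + B_n - gamma) P_(n-1) - (A_(n-1)/beta_(n-1)) P_n.
    Differentiating the first and eliminating P_(n-1) and P_(n-1)' gives the
    differential equation ([ode_of_ladder]). *)

(** * Ladder relations for a linear functional *)

(** Subtracting from p its degree-N coefficient times P_N lowers the degree. *)
Lemma poly_basis_ind (F : fieldType) (P : nat -> {poly F}) (Q : {poly F} -> Prop) (N : nat) :
  (forall n, P n \is monic) -> (forall n, size (P n) = n.+1) ->
  Q 0 -> (forall a (p q : {poly F}), Q p -> Q q -> Q (a *: p + q)) ->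
  (forall n, (n < N)%N -> Q (P n)) ->
  forall p : {poly F}, (size p <= N)%N -> Q p.
Proof.
move=> P_monic P_size Q0 QD; elim: N => [|N IH] QP p sz_p.
  by move: sz_p; rewrite leqn0 size_poly_eq0 => /eqP ->.
rewrite -(subrK (p`_N *: P N) p) addrC; apply: QD; first exact: QP.
apply: IH => [n ltnN|]; first exact/QP/ltnW.
apply/leq_sizeP => j; rewrite leq_eqVlt => /predU1P[<-|ltNj].
  have := P_monic N; rewrite monicE /lead_coef P_size /= => /eqP PN.
  by rewrite coefB coefZ PN mulr1 subrr.
rewrite coefB coefZ (nth_default 0 (leq_trans sz_p ltNj)).
by rewrite [(P N)`_j]nth_default ?P_size// mulr0 subrr.
Qed.

(** The Euler operator X d/dX multiplies the monomial of degree n by n, so the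
    degree-n terms cancel. *)
Lemma size_euler (F : fieldType) (p : {poly F}) n :
  (size p <= n.+1)%N -> (size ('X * p^`() - n%:R *: p)%R <= n)%N.
Proof.
move=> sz_p; apply/leq_sizeP => j; rewrite leq_eqVlt => /predU1P[<-|ltnj].
  rewrite coefB coefZ coefXM; case: n sz_p => [|n] _ /=.
    by rewrite mul0r subrr.
  by rewrite coef_deriv mulr_natl subrr.
rewrite coefB coefZ coefXM; case: j ltnj => // j ltnj /=.
by rewrite coef_deriv (nth_default 0 (leq_trans sz_p ltnj)) mul0rn mulr0 subrr.
Qed.

(** L plays the role of p |-> int p w and M that of p |-> int p v' w. *)
Section LadderRelations.
Variables (F : fieldType) (L M : {poly F} -> F).
Hypotheses (linL : scalar L) (linM : scalar M).
HB.instance Definition _ := GRing.isLinear.Build F {poly F} F _ L linL.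
HB.instance Definition _ := GRing.isLinear.Build F {poly F} F _ M linM.

Let LD p q : L (p + q) = L p + L q. Proof. exact: linearD. Qed.
Let LZ a p : L (a *: p) = a * L p. Proof. exact: linearZ. Qed.
Let MB p q : M (p - q) = M p - M q. Proof. exact: linearB. Qed.
Let MZ a p : M (a *: p) = a * M p. Proof. exact: linearZ. Qed.

Variables (P : nat -> {poly F}) (h beta : nat -> F) (gamma : F).
Hypotheses (P_monic : forall n, P n \is monic)
           (P_size : forall n, size (P n) = n.+1).
Hypothesis h_neq0 : forall n, h n != 0.
Hypothesis P_orth : forall m n, L (P n * P m) = h n * (m == n)%:R.
Hypotheses (P0 : P 0 = 1) (P1 : P 1 = 'X).
Hypothesis P_rec : forall n, P n.+2 = 'X * P n.+1 - beta n.+1 *: P n.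
Hypothesis beta_h : forall n, beta n.+1 = h n.+1 / h n.
Hypothesis pearson :
  forall q, L ('X * q^`() + (1 + gamma) *: q) = M ('X * q).
Hypothesis M_sqr : forall n, M (P n * P n) = 0.

Lemma orthogonal_lower n (p : {poly F}) : (size p <= n)%N -> L (P n * p) = 0.
Proof.
move: p; apply: (poly_basis_ind (P := P)) => //.
- by rewrite mulr0 linear0.
- by move=> a p q Lp Lq; rewrite mulrDr -scalerAr linearP /= Lp Lq mulr0 addr0.
by move=> m ltmn; rewrite P_orth ltn_eqF// mulr0.
Qed.

(** The Christoffel-Darboux kernel K_n(x, .), as a polynomial in its second
    variable. *)
Definition cdk (x : F) n : {poly F} := \sum_(j < n) ((P j).[x] / h j) *: P j.

Lemma size_cdk x n : (size (cdk x n) <= n)%N.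
Proof.
apply: (leq_trans (size_sum _ _ _)); apply/bigmax_leqP => i _.
by apply: (leq_trans (size_scale_leq _ _)); rewrite P_size.
Qed.

Lemma cdk_reproducing x n (p : {poly F}) : (size p <= n)%N -> L (p * cdk x n) = p.[x].
Proof.
move: p; apply: (poly_basis_ind (P := P)) => //.
- by rewrite mul0r linear0 horner0.
- by move=> a p q Lp Lq; rewrite mulrDl -scalerAl linearP /= Lp Lq hornerD hornerZ.
move=> m ltmn; rewrite /cdk mulr_sumr linear_sum /= (bigD1 (Ordinal ltmn)) //=.
rewrite -scalerAr linearZ /= P_orth eqxx mulr1 divfK// big1 ?addr0// => i ne_im.
by rewrite -scalerAr linearZ /= P_orth (negPf (ne_im : i != m :> nat)) !mulr0.
Qed.

Lemma christoffel_darboux x n :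
  (x%:P - 'X) * cdk x n.+1 =
  (h n)^-1 *: ((P n.+1).[x] *: P n - (P n).[x] *: P n.+1).
Proof.
elim: n => [|n IH]; rewrite /cdk big_ord_recr /=.
  rewrite big_ord0 add0r P0 P1 !hornerE -alg_polyC -!mul_polyC; ring.
rewrite -/(cdk x n.+1) mulrDr IH P_rec beta_h !hornerE -!mul_polyC.
have hh : (h n.+1)^-1%:P * (h n.+1)%:P = 1 :> {poly F}.
  by rewrite -polyCM mulVf.
rewrite !polyCM polyCD polyCN !polyCM.
set a := (h n.+1)^-1%:P in hh *; set b := (h n.+1)%:P in hh *.
apply/eqP; rewrite -subr_eq0; apply/eqP.
(* the two sides agree up to the relation a b = 1, so their difference is a
   multiple of 1 - a b *)
transitivity ((1 - a * b) * ((h n)^-1%:P * ((P n.+1).[x]%:P * P n - (P n).[x]%:P * P n.+1))); last first.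
  by rewrite hh subrr mul0r.
by ring.
Qed.

(** Evaluating M(X P_n^2) in two ways, by the Pearson equation and by expanding
    X P_n in the recurrence, gives a first-order recursion in n for this value.
    The gamma part of its solution alternates with the parity of n, and becomes
    the term gamma (1 - (-1)^n)/2 of B_n. *)
Lemma M_consecutive n :
  M (P n.+1 * P n) = h n * (n.+1%:R + gamma * (odd n.+1)%:R).
Proof.
have LXdPP m : L ('X * (P m)^`() * P m) = m%:R * h m.
  rewrite -(subrK (m%:R *: P m) ('X * (P m)^`())) mulrDl LD.
  rewrite mulrC orthogonal_lower ?size_euler ?P_size// add0r.
  by rewrite -scalerAl LZ P_orth eqxx mulr1.
have MXPP m : M ('X * (P m * P m)) = ((m.*2).+1%:R + gamma) * h m.
  rewrite -pearson derivM LD LZ P_orth eqxx.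
  rewrite [X in L X](_ : _ = 'X * (P m)^`() * P m + 'X * (P m)^`() * P m); last by ring.
  by rewrite LD LXdPP -addnn -(addn1 (m + m)) !natrD /=; ring.
elim: n => [|n IH].
  by rewrite P0 P1 mulr1 -[X in M X]mulr1 -[X in 'X * X]mulr1 -P0 MXPP mulr1 mulrC.
rewrite P_rec mulrBl MB /= -mulrA MXPP.
rewrite -scalerAl MZ /= [P n * _]mulrC IH beta_h.
rewrite mulrA divfK// -addnn.
rewrite -(addn1 (n.+1 + n.+1)) -(addn1 n.+1) !natrD /=.
by case: (odd n) => /=; ring.
Qed.

(** Writing y = x - (x - y) in front of the kernel exposes the product
    (x - y) K(x,y), to which the Christoffel-Darboux formula applies. *)
Lemma M_X_cdk x n (p : {poly F}) : M (p * ('X * cdk x n.+1)) =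
  x * M (p * cdk x n.+1) -
  (h n)^-1 * ((P n.+1).[x] * M (p * P n) - (P n).[x] * M (p * P n.+1)).
Proof.
have -> : p * ('X * cdk x n.+1) =
    x *: (p * cdk x n.+1) - p * ((x%:P - 'X) * cdk x n.+1).
  by rewrite -mul_polyC; ring.
rewrite christoffel_darboux MB MZ; congr (_ - _).
by rewrite -scalerAr MZ mulrBr -!scalerAr MB !MZ.
Qed.

(** The Pearson equation for q = P_n K, K the kernel of degree n - 1. In
    X P_n' K the reproducing property needs degree below n, hence the split of
    X P_n' as n P_n plus lower terms; all other terms on the L side vanish by
    orthogonality. The summand n P_n(x) then cancels against the one from
    [M_consecutive]. *)
Lemma lowering x n :
  x * (P n.+1)^`().[x] =
  x * M (P n.+1 * cdk x n.+1) - gamma * (odd n.+1)%:R * (P n.+1).[x].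
Proof.
have := pearson (P n.+1 * cdk x n.+1).
rewrite [in RHS]mulrCA M_X_cdk M_consecutive M_sqr mulr0 subr0.
rewrite [_^-1 * _]mulrCA mulKf// derivM LD LZ.
rewrite (orthogonal_lower (size_cdk x n.+1)) mulr0 addr0.
rewrite [X in L X](_ : _ = ('X * (P n.+1)^`() - n.+1%:R *: P n.+1) * cdk x n.+1
    + n.+1%:R *: (P n.+1 * cdk x n.+1) + P n.+1 * ('X * (cdk x n.+1)^`())); last first.
  by rewrite -!mul_polyC; ring.
rewrite !LD LZ cdk_reproducing ?size_euler ?P_size//.
rewrite (orthogonal_lower (size_cdk x n.+1)) mulr0 addr0.
rewrite orthogonal_lower ?addr0; last first.
  rewrite -(subrK (n%:R *: cdk x n.+1) ('X * _)).
  apply: (leq_trans (size_polyD _ _)); rewrite geq_max.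
  rewrite (leq_trans (size_scale_leq _ _)) ?size_cdk// andbT.
  by apply: leqW; apply: size_euler; exact: size_cdk.
rewrite !hornerE => E.
rewrite -[LHS](subrK (n.+1%:R * (P n.+1).[x])) E; ring.
Qed.

(** The Pearson equation for q = P_(n-1) K with the same kernel as in
    [lowering]. Here K reproduces P_(n-1) and X P_(n-1)', and P_(n-1) only
    sees the leading term of X K'. *)
Lemma raising x n :
  x * (P n)^`().[x] =
  x * M (P n * cdk x n.+1) - gamma * (1 - (odd n.+1)%:R) * (P n).[x].
Proof.
have szP : (size (P n) <= n.+1)%N by rewrite P_size.
have := pearson (P n * cdk x n.+1).
rewrite [in RHS]mulrCA M_X_cdk M_sqr mulr0 sub0r [P n * P n.+1]mulrC M_consecutive.
rewrite mulrN opprK [_^-1 * _]mulrCA mulKf// derivM LD LZ.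
rewrite (cdk_reproducing x szP).
rewrite [X in L X](_ : _ = ('X * (P n)^`() - n%:R *: P n) * cdk x n.+1
    + n%:R *: (P n * cdk x n.+1) + (P n * ('X * (cdk x n.+1)^`() - n%:R *: cdk x n.+1)
    + n%:R *: (P n * cdk x n.+1))); last first.
  by rewrite -!mul_polyC; ring.
rewrite !LD !LZ cdk_reproducing; last exact/leqW/size_euler.
rewrite (cdk_reproducing x szP).
rewrite orthogonal_lower ?add0r; last exact/size_euler/size_cdk.
rewrite !hornerE -[in n.+1%:R]addn1 natrD => E.
rewrite -[LHS](addrK ((n%:R + 1 + gamma) * (P n).[x])).
rewrite [X in X - _ = _](_ : _ = x * M (P n * cdk x n.+1) +
  (P n).[x] * (n%:R + 1 + gamma * (odd n.+1)%:R)); first by ring.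
rewrite /= -E; ring.
Qed.

End LadderRelations.

(** * Integrals over the real line *)

Section RealLine.
Variable R : realType.
Implicit Types f F : R -> R.
Notation mu := (@lebesgue_measure R).

Lemma measurable_compN f : measurable_fun setT f ->
  measurable_fun setT (fun x : R => f (- x)).
Proof. by move=> mf; apply: measurableT_comp. Qed.

Lemma integrable_compN f : mu.-integrable setT (EFin \o f) ->
  mu.-integrable setT (EFin \o (fun x : R => f (- x))).
Proof.
move=> /integrableP[/measurable_EFinP mf foo]; apply/integrableP; split.
  by apply/measurable_EFinP; exact: measurable_compN.
rewrite (_ : \int[mu]_x _ = \int[mu]_x `|(f x)%:E|)%E//.
pose g (y : measurableTypeR R) : \bar R := `|(f y)%:E|%E.
transitivity (\int[mu]_(x in setT) (g \o -%R) x)%E; first by [].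
rewrite -(preimage_setT (-%R : R -> R)) -(@ge0_integral_pushforward _ _ _ (measurableTypeR R))//.
- by apply: eq_measure_integral => A mA _; exact: lebesgue_measureN.
- by apply: measurableT_comp => //; exact/measurable_EFinP.
- by move=> y _; exact: abse_ge0.
Qed.

Lemma Rintegral_compN f : mu.-integrable setT (EFin \o f) ->
  \int[mu]_x f (- x) = \int[mu]_x f x.
Proof.
move=> intf; have /measurable_EFinP mf := measurable_int mu intf.
rewrite /Rintegral; congr fine.
pose g (y : measurableTypeR R) : \bar R := (f y)%:E.
transitivity (\int[mu]_(x in setT) (g \o -%R) x)%E; first by [].
rewrite -(preimage_setT (-%R : R -> R)) -(@integral_pushforward _ _ _ (measurableTypeR R))//.
- by apply: eq_measure_integral => A mA _; exact: lebesgue_measureN.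
- exact/measurable_EFinP.
- by rewrite preimage_setT; exact: integrable_compN.
Qed.

Lemma Rintegral_odd f : (forall x, f (- x) = - f x) ->
  mu.-integrable setT (EFin \o f) -> \int[mu]_x f x = 0.
Proof.
move=> f_odd intf; have := Rintegral_compN intf.
under eq_Rintegral do rewrite f_odd -mulN1r.
by rewrite RintegralZl// => E; lra.
Qed.

(** Otherwise |f| exceeds |l|/2 on a half-line, which has infinite measure. *)
Lemma integrable_cvg_pinfty_eq0 f (l : R) : mu.-integrable setT (EFin \o f) ->
  f x @[x --> +oo] --> l -> l = 0.
Proof.
move=> intf fl; apply/eqP/negPn/negP => l0.
have l20 : 0 < `|l| / 2 by rewrite divr_gt0 ?normr_gt0.
have /integrableP[mf] := intf.
have [M [_ fM]] : \forall x \near +oo, `|l| / 2 <= `|f x|.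
  have /cvg_norm/cvgrPdist_lt := fl => /(_ _ l20); apply: filterS => x.
  by rewrite ltr_norml => /andP[_]; lra.
apply/negP; rewrite -leNgt.
have mI : measurable `]M, +oo[%classic by [].
apply: (@le_trans _ _ (\int[mu]_(x in `]M, +oo[) (`|l| / 2)%:E)%E).
  rewrite integral_cst//= lebesgue_measure_itv/= ltry.
  by rewrite gt0_muley// lte_fin.
apply: (@le_trans _ _ (\int[mu]_(x in `]M, +oo[) `|(EFin \o f) x|)%E).
  apply: ge0_le_integral => //.
  - by apply: measurable_funTS; exact: measurableT_comp.
  - by move=> x /=; rewrite in_itv/= andbT => Mx; rewrite lee_fin fM.
apply: ge0_subset_integral => //.
exact: measurableT_comp.
Qed.

(** The boundary terms F(b) - F(-b) converge to the integral of f, and F being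
    integrable they can only converge to 0. *)
Lemma Rintegral_derivative_eq0 f F :
  continuous f -> (forall x : R, is_derive x 1 F (f x)) ->
  mu.-integrable setT (EFin \o f) -> mu.-integrable setT (EFin \o F) ->
  \int[mu]_x f x = 0.
Proof.
move=> cf dF intf intF.
apply: (@integrable_cvg_pinfty_eq0 (fun x : R => F x - F (- x))).
  rewrite (_ : EFin \o _ = (EFin \o F) \- (EFin \o (fun x : R => (F (- x))%R)))%E//.
  by apply: integrableB => //; exact: integrable_compN.
(* dominated convergence is about sequences, hence the detour through u *)
apply/cvg_pinftyP => u uoo.
have [mf _] := integrableP _ _ _ intf.
have cF : continuous F.
  by move=> x; apply/differentiable_continuous/derivable1_diffP; have [] := dF x.
have FTC b : 0 < b -> \int[mu]_x (f \_ `[- b, b]) x = F b - F (- b).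
  move=> b0; rewrite -Rintegral_mkcond /Rintegral.
  rewrite (@continuous_FTC2 _ f F)//.
  - by rewrite (lt_trans _ b0)// oppr_lt0.
  - exact: continuous_subspaceT.
  - split; first by move=> x _; have [] := dF x.
    + exact/cvg_at_right_filter/cF.
    + exact/cvg_at_left_filter/cF.
  - by move=> x _; rewrite derive1E; have [_ ->] := dF x.
apply: cvg_trans (_ : \int[mu]_x (f \_ `[- u n, u n]) x @[n --> \oo] `=>` _).
  apply: near_eq_cvg; have /cvgryPgt := uoo => /(_ 0); apply: filterS => n un0.
  exact: FTC.
have [] := @dominated_convergence _ _ R mu setT measurableT
  (fun n => EFin \o (f \_ `[- u n, u n])) (EFin \o f) (abse \o (EFin \o f)).
- move=> n; apply/measurable_EFinP/(measurable_restrictT f) => //.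
  by apply: measurable_funTS; exact/measurable_EFinP.
- exact: mf.
- apply: aeW => x _; apply: cvg_near_cst.
  have /cvgryPge := uoo => /(_ `|x|); apply: filterS => n xun /=.
  by rewrite patchE mem_set//= in_itv/= -ler_norml.
- exact: integrable_abse.
- apply: aeW => x n _ /=; rewrite patchE; case: ifPn => _ //.
  by rewrite normr0 lee_fin.
move=> _ _; rewrite -[X in _ `=>` nbhs X]fineK; last exact: integrable_fin_num.
exact: fine_cvg.
Qed.

Lemma continuous_powR_normr (g : R) : 0 < g -> continuous (fun y : R => `|y| `^ g).
Proof.
move=> g0 x; have [->|x0] := eqVneq x 0; last first.
  apply: (@continuous_comp _ _ _ (fun y : R => `|y|) (fun y => y `^ g)).
    exact: norm_continuous.
  apply/differentiable_continuous/derivable1_diffP.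
  by have [] := @is_derive1_powR R g `|x| _; rewrite ?normr_gt0.
rewrite /continuous_at normr0 powR0 ?gt_eqF//.
apply/cvgrPdist_lt => e e0; near=> y; rewrite sub0r normrN ger0_norm ?powR_ge0//.
(* |y|^g < e as soon as |y| < e^(1/g) *)
have -> : e = (e `^ g^-1) `^ g by rewrite -powRrM mulVf ?gt_eqF// powRr1// ltW.
apply: gt0_ltr_powR => //; rewrite ?nnegrE ?powR_ge0//.
by near: y; apply: cvgr0_norm_lt => //; rewrite powR_gt0.
Unshelve. all: by end_near. Qed.

(** The factor y turns |y|^g, not differentiable at 0 when g <= 1, into a C^1
    function: at 0 the difference quotient is |h|^g itself. *)
Lemma is_derive_mul_powR (g x : R) : 0 < g ->
  is_derive x 1 (fun y : R => y * `|y| `^ g) ((1 + g) * `|x| `^ g).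
Proof.
move=> g0.
have powRD1 y : 0 < y -> y * (g * y `^ (g - 1)) = g * y `^ g.
  by move=> y0; rewrite mulrCA mulr_powRB1// ltW.
have [x0|x0|->] := ltgtP x 0.
- apply: (@near_eq_is_derive R R R (fun y : R => y * (- y) `^ g)).
    by near=> y; rewrite ltr0_norm//; near: y; exact: lt_nbhsl.
  have Nx0 : 0 < - x by rewrite oppr_gt0.
  have dN : is_derive x 1 (fun y : R => (- y) `^ g) (g * (- x) `^ (g - 1) * - 1).
    exact: (is_derive1_comp (f := fun y : R => y `^ g) (is_derive1_powR g Nx0) (is_deriveNid x 1)).
  apply: (is_derive_eq (is_deriveM (is_derive_id x 1) dN)); rewrite ltr0_norm//.
  rewrite /GRing.scale /= mulrN1 mulrN -mulNr powRD1//; ring.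
- apply: (@near_eq_is_derive R R R (fun y : R => y * y `^ g)).
    by near=> y; rewrite gtr0_norm//; near: y; exact: lt_nbhsr.
  apply: (is_derive_eq (is_deriveM (is_derive_id x 1) (is_derive1_powR g x0))); rewrite gtr0_norm//.
  rewrite /GRing.scale /= powRD1//; ring.
have cvg0 : h^-1 *: (((fun y : R => y * `|y| `^ g) \o shift 0) (h *: 1) - 0 * `|0 : R| `^ g)
    @[h --> (0 : R)^'] --> (1 + g) * `|0 : R| `^ g.
  rewrite normr0 powR0 ?gt_eqF// !mulr0.
  apply: (@cvg_trans _ ((`|h| `^ g) @[h --> 0^'])).
    apply: near_eq_cvg; near=> h; rewrite /= /GRing.scale /= subr0 addr0 mulr1.
    by rewrite mulKf//; near: h; exact: nbhs_dnbhs_neq.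
  have := continuous_powR_normr g0 (x := 0); rewrite /continuous_at normr0 powR0 ?gt_eqF//.
  by apply: cvg_trans; apply: cvg_within_filter; exact: cvg_id.
by split; [apply/cvg_ex; eexists; exact: cvg0|exact: cvg_lim cvg0].
Unshelve. all: by end_near. Qed.

End RealLine.

(** * Integrating polynomials against a function *)

Section PolynomialIntegrals.
Variable R : realType.
Notation mu := (@lebesgue_measure R).
Variable g : R -> R.

Lemma integrable_poly_span (P : nat -> {poly R}) :
  (forall n, P n \is monic) -> (forall n, size (P n) = n.+1) ->
  (forall n, mu.-integrable setT (EFin \o (fun y => (P n).[y] * g y))) ->
  forall p : {poly R}, mu.-integrable setT (EFin \o (fun y => p.[y] * g y)).
Proof.
move=> P_monic P_size intP p.
pose Q (q : {poly R}) := mu.-integrable setT (EFin \o (fun y => q.[y] * g y)).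
apply: (@poly_basis_ind _ P Q (size p)) => //; rewrite /Q.
- rewrite (_ : _ \o _ = cst 0%:E); first exact: integrable0.
  by apply/funext => y /=; rewrite horner0 mul0r.
- move=> a q r intq intr.
  rewrite (_ : _ \o _ = (cst a%:E \* (EFin \o (fun y => q.[y] * g y)%R)) \+
      (EFin \o (fun y => r.[y] * g y)%R))%E; last first.
    by apply/funext => y /=; rewrite -EFinM -EFinD hornerD hornerZ mulrDl mulrA.
  by apply: integrableD => //; exact: integrableZl.
- by move=> n _; exact: intP.
Qed.

Hypothesis intg :
  forall p : {poly R}, mu.-integrable setT (EFin \o (fun y => p.[y] * g y)).

Lemma scalar_Rintegral_poly : scalar (fun p : {poly R} => \int[mu]_y (p.[y] * g y)).
Proof.
move=> a p q; rewrite /= -RintegralZl//= -RintegralD//; last first.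
  rewrite (_ : _ \o _ = cst a%:E \* (EFin \o (fun y => p.[y] * g y)%R))%E; last first.
    by apply/funext => y /=; rewrite EFinM.
  exact: integrableZl.
by apply: eq_Rintegral => y _; rewrite hornerD hornerZ mulrDl mulrA.
Qed.

End PolynomialIntegrals.

(** * The weight *)

Section Weight.
Variables (R : realType) (gamma t : R) (v : R -> R -> R).
Notation mu := (@lebesgue_measure R).
Hypothesis gamma_gt0 : 0 < gamma.
Hypothesis v_even : forall x : R, v (- x) t = v x t.

(** If f(y) = y w(y) has integral 0, so has its symmetrization
    s(y) = f(y) + f(-y) = y (|y - k|^gamma - |y + k|^gamma) exp(-v(y)). For
    k <> 0 the function k s is negative off the origin, a contradiction. *)
Lemma weight_center_eq0 (k : R) :
  mu.-integrable setT (fun x => (x * weight k gamma v t x)%:E) ->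
  \int[mu]_x (x * weight k gamma v t x) = 0 -> k = 0.
Proof.
move=> intf f0; apply/eqP/negPn/negP => k0.
pose f (x : R) := x * weight k gamma v t x.
pose s (x : R) := f x + f (- x).
have intN : mu.-integrable setT (EFin \o (fun x => f (- x))) by exact: integrable_compN.
have ints : mu.-integrable setT (EFin \o s).
  rewrite (_ : EFin \o _ = (EFin \o f) \+ (EFin \o (fun x => f (- x)%R)))%E//.
  exact: integrableD.
have ks_lt0 x : x != 0 -> k * s x < 0.
  move=> x0; rewrite /s /f /weight v_even.
  have -> : - x - k = - (x + k) by rewrite opprD.
  rewrite normrN mulNr -mulrBr -mulrBl mulrA mulrA pmulr_llt0 ?expR_gt0//.
  have lt_powR a b : `|a| < `|b| -> `|a| `^ gamma < `|b| `^ gamma.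
    by move=> ab; apply: gt0_ltr_powR; rewrite ?nnegrE.
  have lt_norm a b : a ^+ 2 < b ^+ 2 -> `|a| < `|b| :> R.
    by rewrite -(real_normK (num_real a)) -(real_normK (num_real b)) ltr_sqr ?nnegrE.
  have : k * x != 0 by rewrite mulf_neq0.
  rewrite mulrA; case: (ltgtP (k * x) 0) => // kx0 _.
  - rewrite nmulr_rlt0// subr_gt0; apply/lt_powR/lt_norm; nra.
  - rewrite pmulr_rlt0// subr_lt0; apply/lt_powR/lt_norm; nra.
have ks_le0 x : k * s x <= 0.
  have [->|/ks_lt0/ltW//] := eqVneq x 0.
  by rewrite /s /f oppr0 mul0r addr0 mulr0.
have intks : mu.-integrable setT (EFin \o (fun x => k * s x)).
  rewrite (_ : EFin \o _ = cst k%:E \* (EFin \o s))%E; last first.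
    by apply/funext => x /=; rewrite EFinM.
  exact: integrableZl.
have ks0 : \int[mu]_x (k * s x) = 0.
  by rewrite RintegralZl// /s RintegralD//= Rintegral_compN// f0 addr0 mulr0.
have : (\int[mu]_x `|(k * s x)%:E| = 0)%E.
  rewrite -[LHS]fineK; last exact/integrable_fin_num/integrable_abse.
  rewrite (_ : fine _ = \int[mu]_x (- 1 * (k * s x))).
    by rewrite RintegralZl// ks0 mulr0.
  by apply: eq_Rintegral => x _; rewrite ler0_norm// mulN1r.
move=> /ae_eq_integral_abs -/(_ measurableT (measurable_int mu intks))[N [mN N0 sN]].
(* k s vanishes almost everywhere, but nowhere on ]0, 1[ *)
have : (mu `]0%R, 1%R[%classic <= mu N)%E.
  apply: le_measure; rewrite ?inE// => x /=; rewrite in_itv/= => /andP[x0 _].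
  apply: sN => /= /(_ Logic.I)[] /eqP; rewrite lt_eqF//.
  by apply: ks_lt0; rewrite gt_eqF.
by rewrite N0 lebesgue_measure_itv/= lte_fin ltr01 sube0 lee_fin ler10.
Qed.


Hypothesis v_derivable : forall x : R, derivable (fun y : R => v y t) x 1.
Hypothesis v_C1 : continuous (fun x : R => dvdx v t x).

Local Notation w := (weight 0 gamma v t).
Local Notation dv := (dvdx v t).

Let is_derive_v (x : R) : is_derive x 1 (fun y : R => v y t) (dv x).
Proof. by rewrite /dvdx derive1E; exact: derivableP. Qed.

Lemma dvdx_odd (x : R) : dv (- x) = - dv x.
Proof.
have := is_derive1_comp (is_derive_v (- - x)) (is_deriveNid (- x) 1).
rewrite opprK (_ : _ \o _ = fun y : R => v y t); last by apply/funext => y /=.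
by move=> [_]; have [_ ->] := is_derive_v (- x) => ->; rewrite mulrN1.
Qed.

Lemma dvdx0 : dv 0 = 0.
Proof. by have := dvdx_odd 0; rewrite oppr0 => E; lra. Qed.

Lemma weight_even x : w (- x) = w x.
Proof. by rewrite /weight v_even !subr0 normrN. Qed.

Lemma weight0 : w 0 = 0.
Proof. by rewrite /weight subr0 normr0 powR0 ?gt_eqF// mul0r. Qed.

Let continuous_expRv : continuous (fun y : R => expR (- v y t)).
Proof.
move=> x; apply: (@continuous_comp _ _ _ (fun y => - v y t) expR).
  apply/continuousN/differentiable_continuous/derivable1_diffP.
  exact: v_derivable.
exact: continuous_expR.
Qed.

Lemma continuous_weight : continuous w.
Proof.
move=> x; apply: cvgM; last exact: continuous_expRv.
have := continuous_powR_normr gamma_gt0 (x := x).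
by rewrite (_ : (fun y => _) = fun y => `|y - 0| `^ gamma)//;
  apply/funext => y; rewrite subr0.
Qed.

Hypothesis intw : forall p : {poly R}, mu.-integrable setT (EFin \o (fun y => p.[y] * w y)).
Hypothesis intdvw : forall p : {poly R},
  mu.-integrable setT (EFin \o (fun y => p.[y] * (dv y * w y))).

(** The difference of the two integrands is the derivative of y q(y) w(y),
    which is integrable because all moments exist. *)
Lemma pearson_equation (q : {poly R}) :
  \int[mu]_y (('X * q^`() + (1 + gamma) *: q).[y] * w y) =
  \int[mu]_y (('X * q).[y] * (dv y * w y)).
Proof.
apply/eqP; rewrite -subr_eq0 -RintegralB//; apply/eqP.
pose f y := ('X * q^`() + (1 + gamma) *: q).[y] * w y - ('X * q).[y] * (dv y * w y).
pose F y := ('X * q).[y] * w y.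
apply: (@Rintegral_derivative_eq0 _ f F) => //.
- move=> x; apply: cvgB; apply: cvgM; try exact: continuous_horner.
    exact: continuous_weight.
  by apply: cvgM; [exact: v_C1|exact: continuous_weight].
- move=> x.
  have dE : is_derive x 1 (fun y : R => expR (- v y t)) (expR (- v x t) * - dv x).
    exact: (is_derive1_comp (f := expR) (is_derive_expR _) (is_deriveN (is_derive_v x))).
  have := is_deriveM (is_deriveM (is_derive_mul_powR x gamma_gt0) (is_derive_poly q x)) dE.
  rewrite (_ : _ * _ = F); last first.
    apply/funext => y; rewrite !fctE /F /weight subr0 !hornerE /=; ring.
  move=> dF; apply: (is_derive_eq dF); rewrite !fctE /f /weight subr0 !hornerE /GRing.scale /=; ring.
- rewrite (_ : EFin \o _ = (EFin \o (fun y => ('X * q^`() + (1 + gamma) *: q).[y] * w y)%R) \-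
    (EFin \o (fun y => ('X * q).[y] * (dv y * w y))%R))%E//.
  exact: integrableB.
- exact: intw.
Qed.

End Weight.

(** * Ladder relations for the orthogonal polynomials *)

Section Orthogonal.
Variables (R : realType) (gamma t : R) (v : R -> R -> R).
Variables (P : nat -> R -> {poly R}) (h beta : nat -> R -> R).
Notation mu := (@lebesgue_measure R).
Hypothesis gamma_gt0 : 0 < gamma.
Hypothesis v_even : forall x : R, v (- x) t = v x t.
Hypothesis v_derivable : forall x : R, derivable (fun y : R => v y t) x 1.
Hypothesis v_C1 : continuous (fun x : R => dvdx v t x).
Hypothesis intw : forall p : {poly R},
  mu.-integrable setT (EFin \o (fun y => p.[y] * weight 0 gamma v t y)).
Hypotheses (P_monic : forall n, P n t \is monic)
           (P_size : forall n, size (P n t) = n.+1).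
Hypothesis h_gt0 : forall n, 0 < h n t.
Hypothesis P_orth : forall m n : nat,
  \int[mu]_x ((P n t).[x] * (P m t).[x] * weight 0 gamma v t x)
  = h n t * (m == n)%:R.
Hypotheses (P0 : P 0%N t = 1) (P1 : P 1%N t = 'X).
Hypothesis P_rec : forall n, P n.+2 t = 'X * P n.+1 t - beta n.+1 t *: P n t.
Hypothesis beta_h : forall n, beta n.+1 t = h n.+1 t / h n t.
Hypothesis intA : forall (n : nat) (x : R),
  mu.-integrable setT (EFin \o A_integrand 0 gamma v P n.+1 t x).
Hypothesis intB : forall (n : nat) (x : R),
  mu.-integrable setT (EFin \o B_integrand 0 gamma v P n.+1 t x).

Local Notation w := (weight 0 gamma v t).
Local Notation dv := (dvdx v t).

Lemma parity n y : (P n t).[- y] = (-1) ^+ n * (P n t).[y].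
Proof.
elim/ltn_ind: n => -[|[|n]] IH.
- by rewrite P0 !hornerE.
- by rewrite P1 !hornerE expr1 mulN1r.
by rewrite P_rec !hornerE !IH// !exprS; ring.
Qed.

Lemma B_integrand0 n y :
  B_integrand 0 gamma v P n.+1 t 0 y = (P n.+1 t).[y] * (P n t).[y] * (dv y / y) * w y.
Proof.
by rewrite /B_integrand /Kker dvdx0// !sub0r invrN mulrNN.
Qed.

(** Multiplying the recurrence by P_(n+1)/y gives
    P_(n+1)^2 = P_(n+2) P_(n+1)/y + beta_(n+1) P_(n+1) P_n/y,
    so that the left side times v' w is a combination of B-integrands at
    x = 0. The value at y = 0 is harmless because w(0) = 0. *)
Lemma integrable_sqr_dv n :
  mu.-integrable setT (EFin \o (fun y => (P n t).[y] ^+ 2 * (dv y * w y))).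
Proof.
have w0 : w 0 = 0 by exact: weight0.
case: n => [|n].
  rewrite (_ : (fun y => _) = B_integrand 0 gamma v P 1 t 0); first exact: intB.
  apply/funext => y; rewrite B_integrand0 P0 P1 hornerC hornerX.
  have [->|y0] := eqVneq y 0; first by rewrite w0 !mulr0.
  by field.
rewrite (_ : EFin \o _ = (EFin \o B_integrand 0 gamma v P n.+2 t 0) \+
  (cst (beta n.+1 t)%:E \* (EFin \o B_integrand 0 gamma v P n.+1 t 0)))%E.
  apply: integrableD; [by []|exact: intB|].
  by apply: integrableZl; [by []|exact: intB].
apply/funext => y /=; rewrite -EFinM -EFinD; congr EFin.
rewrite !B_integrand0 P_rec hornerD hornerN hornerZ hornerM hornerX.
have [->|y0] := eqVneq y 0; first by rewrite w0 !mulr0 addr0.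
by field.
Qed.

(** |P_n| <= P_n^2 + 1 = P_n^2 + P_0^2, and the P_n span all polynomials. *)
Lemma integrable_dv (p : {poly R}) :
  mu.-integrable setT (EFin \o (fun y => p.[y] * (dv y * w y))).
Proof.
apply: (@integrable_poly_span _ _ (P ^~ t)) => // n.
have mdv : measurable_fun setT (fun y => dv y * w y).
  apply: measurable_funM; apply: continuous_measurable_fun => //.
  exact: continuous_weight.
apply: (@le_integrable _ _ _ mu setT _ _ (EFin \o (fun y =>
    (P n t).[y] ^+ 2 * (dv y * w y) + (P 0 t).[y] ^+ 2 * (dv y * w y)))) => //.
- apply/measurable_EFinP; apply: measurable_funM => //.
  by apply: continuous_measurable_fun; exact: continuous_horner.
- move=> y _; rewrite /= lee_fin P0 hornerC expr1n -mulrDl !normrM.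
  rewrite ler_wpM2r ?mulr_ge0// [leRHS]ger0_norm ?addr_ge0 ?sqr_ge0//.
  by rewrite -(real_normK (num_real (P n t).[y])); nra.
- rewrite (_ : EFin \o _ = (EFin \o (fun y => (P n t).[y] ^+ 2 * (dv y * w y))%R) \+
    (EFin \o (fun y => (P 0 t).[y] ^+ 2 * (dv y * w y))%R))%E//.
  by apply: integrableD => //; exact: integrable_sqr_dv.
Qed.

Let L (p : {poly R}) := \int[mu]_y (p.[y] * w y).
Let M (p : {poly R}) := \int[mu]_y (p.[y] * (dv y * w y)).
Let K x n := cdk (P ^~ t) (h ^~ t) x n.

Let linL : scalar L. Proof. exact: scalar_Rintegral_poly. Qed.
Let linM : scalar M. Proof. exact/scalar_Rintegral_poly/integrable_dv. Qed.
Let h_neq0 n : h n t != 0. Proof. by rewrite gt_eqF. Qed.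

Let orth m n : L (P n t * P m t) = h n t * (m == n)%:R.
Proof. by rewrite -P_orth; apply: eq_Rintegral => y _; rewrite hornerM. Qed.

Let pearson q : L ('X * q^`() + (1 + gamma) *: q) = M ('X * q).
Proof. exact/pearson_equation/integrable_dv. Qed.

Let M_sqr n : M (P n t * P n t) = 0.
Proof.
apply: Rintegral_odd; last exact: integrable_dv.
move=> y; rewrite !hornerM !parity dvdx_odd// weight_even//.
have := sqrr_sign R n; rewrite expr2 => sgn.
by rewrite [X in X * _]mulrACA sgn mul1r mulNr mulrN.
Qed.

(** Under the integral sign v'(x) - v'(y) is (x - y) times the divided
    difference of v', and the factor x - y is absorbed by the
    Christoffel-Darboux formula for K. *)
Lemma kernel_integral x n (p : {poly R}) (f g : R -> R) :
  mu.-integrable setT (EFin \o f) -> mu.-integrable setT (EFin \o g) ->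
  (forall y, f y = p.[y] * (P n t).[y] * Kker v t x y * w y) ->
  (forall y, g y = p.[y] * (P n.+1 t).[y] * Kker v t x y * w y) ->
  dv x * L (p * K x n.+1) - M (p * K x n.+1) =
  (h n t)^-1 * ((P n.+1 t).[x] * \int[mu]_y f y - (P n t).[x] * \int[mu]_y g y).
Proof.
move=> intf intg fE gE.
have intZ (c : R) (u : R -> R) : mu.-integrable setT (EFin \o u) ->
    mu.-integrable setT (EFin \o (fun y => c * u y)).
  move=> intu; rewrite (_ : EFin \o _ = cst c%:E \* (EFin \o u))%E; last first.
    by apply/funext => y /=; rewrite EFinM.
  exact: integrableZl.
have cd y : (x - y) * (K x n.+1).[y] =
    (h n t)^-1 * ((P n.+1 t).[x] * (P n t).[y] - (P n t).[x] * (P n.+1 t).[y]).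
  have /(congr1 (horner^~ y)) := christoffel_darboux (beta := beta ^~ t) h_neq0 P0 P1 P_rec beta_h x n.
  by rewrite !hornerE.
have kE y : dv x - dv y = (x - y) * Kker v t x y.
  rewrite /Kker; have [->|xy] := eqVneq x y; first by rewrite !subrr mul0r.
  by rewrite mulrC divfK// subr_eq0.
have CDK y : dv x * (p.[y] * (K x n.+1).[y] * w y) - p.[y] * (K x n.+1).[y] * (dv y * w y) =
    (h n t)^-1 * ((P n.+1 t).[x] * (p.[y] * (P n t).[y] * Kker v t x y * w y) -
    (P n t).[x] * (p.[y] * (P n.+1 t).[y] * Kker v t x y * w y)).
  transitivity (p.[y] * w y * (K x n.+1).[y] * (dv x - dv y)); first by ring.
  rewrite kE; transitivity (p.[y] * w y * Kker v t x y * ((x - y) * (K x n.+1).[y])).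
    by ring.
  by rewrite cd; ring.
pose q := p * K x n.+1.
transitivity (\int[mu]_y (dv x * (q.[y] * w y) - q.[y] * (dv y * w y))).
  rewrite RintegralB//; [by rewrite RintegralZl|exact: intZ|exact: integrable_dv].
transitivity (\int[mu]_y ((h n t)^-1 * ((P n.+1 t).[x] * f y - (P n t).[x] * g y))).
  apply: eq_Rintegral => y _; rewrite /q fE gE hornerM; exact: CDK.
rewrite RintegralZl//; last first.
  rewrite (_ : EFin \o _ = (EFin \o (fun y => (P n.+1 t).[x] * f y)%R) \-
    (EFin \o (fun y => (P n t).[x] * g y)%R))%E//.
  by apply: integrableB => //; exact: intZ.
by rewrite RintegralB ?RintegralZl//; exact: intZ.
Qed.

Local Notation A := (A_coef 0 gamma v P h).
Local Notation B := (B_coef 0 gamma v P h).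

Let sign_odd n : 2^-1 * gamma * (1 - (-1) ^+ n) = gamma * (odd n)%:R.
Proof. by rewrite -signr_odd; case: (odd n); rewrite /= ?expr1 ?expr0; field. Qed.

(** In [lowering] the value M(P_n K) is -int P_n K (v'(x) - v'(y)) w, because
    P_n is orthogonal to K. *)
Lemma lowering_AB n x :
  x * (P n.+1 t)^`().[x] = A n.+1 t x * (P n t).[x] - B n.+1 t x * (P n.+1 t).[x].
Proof.
rewrite (lowering (beta := beta ^~ t) linL linM P_monic P_size h_neq0 orth P0 P1 P_rec beta_h pearson M_sqr).
have := @kernel_integral x n (P n.+1 t) (B_integrand 0 gamma v P n.+1 t x)
  (A_integrand 0 gamma v P n.+1 t x) (intB _ _) (intA _ _) _ _.
rewrite (orthogonal_lower linL P_monic P_size orth (size_cdk _ P_size x n.+1)).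
rewrite mulr0 sub0r => /(_ _ _)/(congr1 -%R); rewrite opprK => ->//.
by rewrite /A_coef /B_coef subr0 sign_odd /=; ring.
Qed.

(** Here L(P_(n-1) K) = P_(n-1)(x), which is the source of the term
    x v'(x) P_(n-1)(x). *)
Lemma raising_AB n x :
  x * (P n.+1 t)^`().[x] =
  (x * dv x + B n.+2 t x - gamma) * (P n.+1 t).[x] -
  A n.+1 t x / beta n.+1 t * (P n.+2 t).[x].
Proof.
rewrite (raising (beta := beta ^~ t) linL linM P_monic P_size h_neq0 orth P0 P1 P_rec beta_h pearson M_sqr).
have := @kernel_integral x n.+1 (P n.+1 t) (A_integrand 0 gamma v P n.+1 t x)
  (B_integrand 0 gamma v P n.+2 t x) (intA _ _) (intB _ _) _ _.
rewrite (cdk_reproducing linL P_monic P_size h_neq0 orth) ?P_size//.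
move=> /(_ _ _) E.
have -> : M (P n.+1 t * K x n.+2) = dv x * (P n.+1 t).[x] - ((h n.+1 t)^-1 *
    ((P n.+2 t).[x] * (\int[mu]_y A_integrand 0 gamma v P n.+1 t x y) -
     (P n.+1 t).[x] * (\int[mu]_y B_integrand 0 gamma v P n.+2 t x y))).
  rewrite -E; first by rewrite opprB addrC subrK.
  - by move=> y; rewrite /A_integrand expr2.
  - by move=> y; rewrite /B_integrand /= [(P n.+2 t).[y] * _]mulrC.
rewrite /A_coef /B_coef subr0 sign_odd beta_h /=; field.
by rewrite !h_neq0.
Qed.

End Orthogonal.

(** * The differential equation *)

(** The first relation is assumed for all y, as it gets differentiated at x; the
    second one serves to eliminate q'(x). *)
Lemma ode_of_ladder (R : realType) (A B : R -> R) (p q : {poly R}) (x g d c : R) :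
  x != 0 -> A x != 0 -> derivable A x 1 -> derivable B x 1 ->
  (forall y, y * p^`().[y] = A y * q.[y] - B y * p.[y]) ->
  x * q^`().[x] = (x * d + B x - g) * q.[x] - c * p.[x] ->
  x * p^`()^`().[x] + (g - x * d - x / A x * derive1 A x + 1) * p^`().[x]
  + (A x * c / x + derive1 B x + g * B x / x - B x * (d + B x / x)
     - B x / A x * derive1 A x) * p.[x] = 0.
Proof.
move=> x0 Ax0 dA dB low raise.
have isA : is_derive x 1 A (derive1 A x) by rewrite derive1E; exact: derivableP.
have isB : is_derive x 1 B (derive1 B x) by rewrite derive1E; exact: derivableP.
have low' : A x * q^`().[x] + q.[x] * derive1 A x =
    (x * p^`()^`().[x] + p^`().[x] * 1) + (B x * p^`().[x] + p.[x] * derive1 B x).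
  have [_ <-] := is_deriveM isA (is_derive_poly q x).
  have [_ <-] := is_deriveD (is_deriveM (is_derive_id x 1) (is_derive_poly p^`() x))
                            (is_deriveM isB (is_derive_poly p x)).
  congr ('D_1 _ x); apply/funext => y; rewrite !fctE low; ring.
have qE : q.[x] = (x * p^`().[x] + B x * p.[x]) / A x.
  by rewrite low subrK mulrAC divff// mul1r.
have q'E : q^`().[x] = ((x * d + B x - g) * q.[x] - c * p.[x]) / x.
  by rewrite -raise mulrAC divff// mul1r.
have -> : x * p^`()^`().[x] = A x * q^`().[x] + q.[x] * derive1 A x
    - p^`().[x] - B x * p^`().[x] - p.[x] * derive1 B x.
  by rewrite low'; ring.
rewrite q'E qE; field.
by rewrite x0 Ax0.
Qed.

Theorem theorem2p6 (R : realType) (k gamma t : R) (v : R -> R -> R)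
  (P : nat -> R -> {poly R}) (h beta : nat -> R -> R)
  (gamma_ge1 : 1 <= gamma)
  (v_even : forall x : R, v (- x) t = v x t)
  (v_derivable : forall x : R, derivable (fun y : R => v y t) x 1)
  (v_C1 : continuous (fun x : R => dvdx v t x))
  (moments : forall m : nat,
    (@lebesgue_measure R).-integrable setT
      (fun x : R => (x ^+ m * weight k gamma v t x)%:E))
  (P_monic : forall m : nat, P m t \is monic)
  (P_size : forall m : nat, size (P m t) = m.+1)
  (h_gt0 : forall m : nat, 0 < h m t)
  (P_orthogonal : forall m n : nat,
    \int[@lebesgue_measure R]_x
      ((P n t).[x] * (P m t).[x] * weight k gamma v t x)
    = h n t * (m == n)%:R)
  (P0 : P 0%N t = 1)
  (P1 : P 1%N t = 'X)
  (P_rec : forall m : nat, (1 <= m)%N ->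
    P m.+1 t = 'X * P m t - beta m t *: P m.-1 t)
  (beta_h : forall m : nat, (1 <= m)%N -> beta m t = h m t / h m.-1 t)
  (A_converges : forall (m : nat) (x : R), (1 <= m)%N ->
    (@lebesgue_measure R).-integrable setT
      (fun y : R => (A_integrand k gamma v P m t x y)%:E))
  (B_converges : forall (m : nat) (x : R), (1 <= m)%N ->
    (@lebesgue_measure R).-integrable setT
      (fun y : R => (B_integrand k gamma v P m t x y)%:E)) :
  forall (n : nat) (x : R), (2 <= n)%N ->
    x != k ->
    A_coef k gamma v P h n t x != 0 ->
    derivable (A_coef k gamma v P h n t) x 1 ->
    derivable (B_coef k gamma v P h n t) x 1 ->
    (x - k) * (deriv (deriv (P n t))).[x]
    + R_coef k gamma v P h n t x * (deriv (P n t)).[x]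
    + T_coef k gamma v P h beta n t x * (P n t).[x] = 0.
Proof.
have gamma_gt0 : 0 < gamma by exact: lt_le_trans gamma_ge1.
have k0 : k = 0.
  apply: (@weight_center_eq0 R gamma t v gamma_gt0 v_even); first exact: (moments 1%N).
  have := P_orthogonal 0%N 1%N; rewrite mulr0 => <-.
  by apply: eq_Rintegral => x _; rewrite P0 P1 hornerX hornerC mulr1.
subst k.
have intw := @integrable_poly_span R (weight 0 gamma v t) (fun m => 'X^m)
  (fun m => monicXn R m) (size_polyXn R).
have {}intw p : (@lebesgue_measure R).-integrable setT
    (EFin \o (fun y => p.[y] * weight 0 gamma v t y)).
  apply: intw => m; rewrite (_ : (fun y => _) = fun y => y ^+ m * weight 0 gamma v t y).
    exact: moments.
  by apply/funext => y; rewrite hornerXn.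
case=> [|[|n]] x // _ x0 A0 dA dB.
have P_rec' m : P m.+2 t = 'X * P m.+1 t - beta m.+1 t *: P m t by exact: P_rec.
have beta_h' m : beta m.+1 t = h m.+1 t / h m t by exact: beta_h.
have low y := lowering_AB gamma_gt0 v_even v_derivable v_C1 intw P_monic P_size h_gt0
  P_orthogonal P0 P1 P_rec' beta_h' (fun m y => A_converges m.+1 y isT)
  (fun m y => B_converges m.+1 y isT) n.+1 y.
have raise := raising_AB gamma_gt0 v_even v_derivable v_C1 intw P_monic P_size h_gt0
  P_orthogonal P0 P1 P_rec' beta_h' (fun m y => A_converges m.+1 y isT)
  (fun m y => B_converges m.+1 y isT) n x.
rewrite -[RHS](ode_of_ladder x0 A0 dA dB low raise).
rewrite /R_coef /T_coef !subr0; congr (_ + _ * _).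
by rewrite /= invfM; ring.
Qed.
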